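(* Let $R$ be a local Cohen-Macaulay ring with infinite residue field $k$, let $I$ be an $R$-ideal with $\ell(I)=\operatorname{ht} I=1$ and $r=r(I)$, and let $J$ be a minimal reduction of $I$. Let $(y_1),\ldots,(y_t)$ be minimal reductions of $I$ such that $\operatorname{core}(I)=(y_1)\cap\cdots\cap(y_t)$, and write $s=\max\{r((J,y_i)) \mid 1\le i\le t\}$. (a) For every $n\ge s$, $$\operatorname{core}(I)=J^{n+1}:\sum_{y\in I}(J,y)^n=J\Big(J^n:\sum_{y\in I}(J,y)^n\Big)=J^{n+1}:\sum_{i=1}^t(J,y_i)^n=J\Big(J^n:\sum_{i=1}^t(J,y_i)^n\Big).$$ (b) If $\operatorname{char} k=0$ or $\operatorname{char} k>r$, then $$\operatorname{core}(I)=J^{n+1}:I^n=J(J^n:I^n)$$ for every $n\ge r$.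
   Context: Local rings are Noetherian. For ideals $J\subset I$ in a Noetherian ring, $J$ is a reduction of $I$ if $I^{n+1}=JI^n$ for some $n\ge 0$; then $r_J(I)$ denotes the least such $n$. A minimal reduction is a reduction minimal with respect to inclusion. The reduction number is $r(I)=\min\{r_J(I)\}$, with $J$ ranging over all minimal reductions of $I$. $\operatorname{core}(I)$ is the intersection of all reductions of $I$. For $R$ local with residue field $k$, the analytic spread is $\ell(I)=\dim\big(\operatorname{gr}_I(R)\otimes_R k\big)$. $(J,y)$ denotes the ideal $J+(y)$. Colons are ideal quotients in $R$, and the $0$-th power of an ideal is $R$. *)

(* Defs.v *)
From HB Require Import structures.
From mathcomp Require Import all_boot all_order all_algebra.
From mathcomp Require Import mathcomp_extra boolp classical_sets functions cardinality.

Set Implicit Arguments.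
Unset Strict Implicit.
Unset Printing Implicit Defensive.

Import GRing.Theory.

Local Open Scope classical_set_scope.
Local Open Scope ring_scope.
Local Open Scope quotient_scope.

Declare Scope ideal_scope.
Delimit Scope ideal_scope with ID.

Identity Coercion set_to_fun : set >-> Funclass.

(** MathComp's [idealr] only covers proper ideals, whereas the zeroth power of
    an ideal and colon ideals may be the whole ring. *)

Record ideal (R : comPzRingType) := Ideal {
  ideal_set :> set R;
  ideal0 : ideal_set 0;
  idealD : forall x y, ideal_set x -> ideal_set y -> ideal_set (x + y);
  idealM : forall a x, ideal_set x -> ideal_set (a * x)
}.

Bind Scope ideal_scope with ideal.

Section IdealOperations.
Variable R : comPzRingType.
Implicit Types (I J K : ideal R) (S : set R).

Lemma ideal_eqP I J : (I : set R) = J -> I = J.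
Proof.
case: I J => [I I0 ID IM] [J J0 JD JM] /= eqIJ; subst J.
by congr Ideal; exact: Prop_irrelevance.
Qed.

Lemma idealN I x : I x -> I (- x).
Proof. by move=> Ix; rewrite -mulN1r; exact: idealM. Qed.

Definition ideal_top : ideal R :=
  @Ideal R setT Logic.I (fun _ _ _ _ => Logic.I) (fun _ _ _ => Logic.I).

Definition gen_set S : set R := [set x | forall I, S `<=` I -> I x].

Fact gen_set0 S : gen_set S 0.
Proof. by move=> I _; exact: ideal0. Qed.

Fact gen_setD S x y : gen_set S x -> gen_set S y -> gen_set S (x + y).
Proof. by move=> Sx Sy I SI; apply: idealD; [exact: Sx | exact: Sy]. Qed.

Fact gen_setM S a x : gen_set S x -> gen_set S (a * x).
Proof. by move=> Sx I SI; apply: idealM; exact: Sx. Qed.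

Definition ideal_gen S : ideal R :=
  Ideal (@gen_set0 S) (@gen_setD S) (@gen_setM S).

Definition ideal_principal (y : R) : ideal R := ideal_gen [set y].

Definition ideal_add I J : ideal R := ideal_gen (I `|` J).

Definition ideal_mul I J : ideal R := ideal_gen [set a * b | a in I & b in J].

Lemma ideal_mulP I J a b : I a -> J b -> ideal_mul I J (a * b).
Proof. by move=> Ia Jb K; apply; exists a => //; exists b. Qed.

Lemma ideal_mul_sub I J K :
  (forall a b, I a -> J b -> K (a * b)) -> ideal_mul I J `<=` K.
Proof. by move=> IJK x; apply=> _ [a Ia [b Jb <-]]; exact: IJK. Qed.

Definition ideal_exp I n : ideal R := iter n (ideal_mul I) ideal_top.

Definition colon_set I J : set R := [set a | forall b, J b -> I (a * b)].

Fact colon_set0 I J : colon_set I J 0.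
Proof. by move=> b _; rewrite mul0r; exact: ideal0. Qed.

Fact colon_setD I J x y :
  colon_set I J x -> colon_set I J y -> colon_set I J (x + y).
Proof.
by move=> Ix Iy b Jb; rewrite mulrDl; apply: idealD; [exact: Ix | exact: Iy].
Qed.

Fact colon_setM I J a x : colon_set I J x -> colon_set I J (a * x).
Proof. by move=> Ix b Jb; rewrite -mulrA; apply: idealM; exact: Ix. Qed.

Definition ideal_colon I J : ideal R :=
  Ideal (@colon_set0 I J) (@colon_setD I J) (@colon_setM I J).

Definition ideal_bigsum (T : Type) (D : set T) (F : T -> ideal R) : ideal R :=
  ideal_gen (\bigcup_(i in D) F i).

Section BigCap.
Variables (T : Type) (D : set T) (F : T -> ideal R).

Fact bigcap0 : (\bigcap_(i in D) F i) 0.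
Proof. by move=> i _; exact: ideal0. Qed.

Fact bigcapD x y : (\bigcap_(i in D) F i) x -> (\bigcap_(i in D) F i) y ->
  (\bigcap_(i in D) F i) (x + y).
Proof. by move=> Fx Fy i Di; apply: idealD; [exact: Fx | exact: Fy]. Qed.

Fact bigcapM a x : (\bigcap_(i in D) F i) x -> (\bigcap_(i in D) F i) (a * x).
Proof. by move=> Fx i Di; apply: idealM; exact: Fx. Qed.

Definition ideal_bigcap : ideal R := Ideal bigcap0 bigcapD bigcapM.

End BigCap.

Definition prime_ideal I : Prop :=
  ~ I 1 /\ forall a b, I (a * b) -> I a \/ I b.

Definition maximal_ideal I : Prop :=
  ~ I 1 /\ forall K, I `<=` K -> ~ K 1 -> K = I.

End IdealOperations.

Notation "I + J" := (ideal_add I J) : ideal_scope.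
Notation "I * J" := (ideal_mul I J) : ideal_scope.
Notation "I ^+ n" := (ideal_exp I n) : ideal_scope.
Notation "\colon ( I , J )" := (ideal_colon I J)
  (at level 0, format "\colon ( I ,  J )") : ideal_scope.

Section QuotientRing.
Variables (R : comPzRingType) (I : ideal R).

Definition ideal_mem : R -> bool := fun x => `[< I x >].

Fact ideal_mem_zmod_closed : zmod_closed ideal_mem.
Proof.
split=> [|x y /asboolP Ix /asboolP Iy]; apply/asboolP; first exact: ideal0.
by apply: idealD => //; exact: idealN.
Qed.

HB.instance Definition _ :=
  GRing.isZmodClosed.Build R ideal_mem ideal_mem_zmod_closed.

Definition ideal_mem_closed : zmodClosed R :=
  GRing.ZmodClosed.clone R ideal_mem _.

Definition quotient : Type := Quotient.quot ideal_mem_closed.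

HB.instance Definition _ := GRing.Zmodule.on quotient.
HB.instance Definition _ := EqQuotient.on quotient.

Definition quotient_pi (x : R) : quotient := \pi_(Quotient.quot ideal_mem_closed) x.

Lemma quotient_piP x y : quotient_pi x = quotient_pi y <-> I (x - y).
Proof.
rewrite /quotient_pi; split => [/eqP|Ixy].
  by rewrite -Quotient.idealrBE => /asboolP.
by apply/eqP; rewrite -Quotient.idealrBE; apply/asboolP.
Qed.

Lemma quotient_reprK (x : quotient) : quotient_pi (repr x) = x.
Proof. exact: reprK. Qed.

Definition quotient_one : quotient := quotient_pi 1.
Definition quotient_mul (x y : quotient) : quotient :=
  quotient_pi (repr x * repr y).

Fact quotient_piM x y :
  quotient_pi (x * y) = quotient_mul (quotient_pi x) (quotient_pi y).
Proof.
apply/quotient_piP.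
set x' := repr (quotient_pi x); set y' := repr (quotient_pi y).
have Ix : I (x - x') by apply/quotient_piP; rewrite quotient_reprK.
have Iy : I (y - y') by apply/quotient_piP; rewrite quotient_reprK.
have -> : x * y - x' * y' = y * (x - x') + x' * (y - y').
  by rewrite !mulrBr addrA [y * x]mulrC [y * x']mulrC subrK.
by apply: idealD; exact: idealM.
Qed.

Fact quotient_piD x y :
  quotient_pi (x + y) = quotient_pi x + quotient_pi y.
Proof. exact: Quotient.pi_add. Qed.

Fact quotient_mulA : associative quotient_mul.
Proof.
move=> x y z.
rewrite -(quotient_reprK x) -(quotient_reprK y) -(quotient_reprK z).
by rewrite -!quotient_piM mulrA.
Qed.

Fact quotient_mulC : commutative quotient_mul.
Proof. by move=> x y; rewrite /quotient_mul mulrC. Qed.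

Fact quotient_mul1 : left_id quotient_one quotient_mul.
Proof.
by move=> x; rewrite -(quotient_reprK x) -quotient_piM mul1r.
Qed.

Fact quotient_mulDl : left_distributive quotient_mul +%R.
Proof.
move=> x y z.
rewrite -(quotient_reprK x) -(quotient_reprK y) -(quotient_reprK z).
by rewrite -quotient_piD -!quotient_piM -quotient_piD mulrDl.
Qed.

HB.instance Definition _ := GRing.Zmodule_isComPzRing.Build quotient
  quotient_mulA quotient_mulC quotient_mul1 quotient_mulDl.

Fact quotient_pi_zmod_morphism : zmod_morphism quotient_pi.
Proof.
move=> x y; rewrite quotient_piD; congr (_ + _).
exact: Quotient.pi_opp.
Qed.

Fact quotient_pi_monoid_morphism : monoid_morphism quotient_pi.
Proof. by split=> // x y; exact: quotient_piM. Qed.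

HB.instance Definition _ :=
  GRing.isZmodMorphism.Build R quotient quotient_pi quotient_pi_zmod_morphism.
HB.instance Definition _ :=
  GRing.isMonoidMorphism.Build R quotient quotient_pi
    quotient_pi_monoid_morphism.

End QuotientRing.

(** [A/IA], which is the tensor product of the [R]-algebra [A] with [R/I]. *)
Definition base_change (R A : comPzRingType) (f : {rmorphism R -> A})
    (I : ideal R) : Type :=
  quotient (ideal_gen (f @` I)).
HB.instance Definition _ (R A : comPzRingType) (f : {rmorphism R -> A})
    (I : ideal R) :=
  GRing.ComPzRing.on (base_change f I).

Definition is_max (S : set nat) (n : nat) : Prop :=
  S n /\ forall k, S k -> (k <= n)%N.

Definition is_min (S : set nat) (n : nat) : Prop :=
  S n /\ forall k, S k -> (n <= k)%N.

(** The least element of [S]; the value 0 for empty [S] is junk. *)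
Definition nat_min (S : set nat) : nat := xget 0%N (is_min S).

Section Dimension.
Variable R : comPzRingType.
Implicit Types (I P : ideal R) (s : seq R).

Definition prime_chain (n : nat) (P : nat -> ideal R) : Prop :=
  (forall i, (i <= n)%N -> prime_ideal (P i)) /\
  (forall i, (i < n)%N -> P i `<` P i.+1).

Definition krull_dim_is : nat -> Prop :=
  is_max [set n | exists P : nat -> ideal R, prime_chain n P].

Definition prime_height_is P : nat -> Prop :=
  is_max [set n | exists2 Q, prime_chain n Q & Q n = P].

Definition height_is I : nat -> Prop :=
  is_min [set h | exists P, [/\ prime_ideal P, I `<=` P & prime_height_is P h]].

Definition noetherian : Prop :=
  forall I, exists s : seq R, I = ideal_gen [set` s].

Definition regular_sequence s : Prop :=
  ~ ideal_gen [set` s] 1 /\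
  forall i, (i < size s)%N -> forall a,
    ideal_gen [set` take i s] (a * s`_i) -> ideal_gen [set` take i s] a.

Definition depth_is I : nat -> Prop :=
  is_max [set n | exists s, [/\ regular_sequence s, [set` s] `<=` I & size s = n]].

End Dimension.

Arguments krull_dim_is : clear implicits.
Arguments noetherian : clear implicits.

Record max_ideal (R : comPzRingType) := MaxIdeal {
  max_ideal_ideal :> ideal R;
  max_idealP : maximal_ideal max_ideal_ideal
}.

Section Local.
Variables (R : comPzRingType) (m : max_ideal R).

Definition residue_field : Type := quotient m.
HB.instance Definition _ := GRing.ComPzRing.on residue_field.

Fact residue_field_oner_neq0 : (1 : residue_field) != 0.
Proof.
apply/eqP; rewrite -(rmorph0 (quotient_pi m)) -(rmorph1 (quotient_pi m)).
by move=> /quotient_piP; rewrite subr0; case: (max_idealP m).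
Qed.

HB.instance Definition _ :=
  GRing.PzSemiRing_isNonZero.Build residue_field residue_field_oner_neq0.

Definition local_ring : Prop :=
  noetherian R /\ forall n : ideal R, maximal_ideal n -> n = m.

Definition cohen_macaulay : Prop :=
  exists d, krull_dim_is R d /\ depth_is m d.

End Local.

Section AssociatedGraded.
Variables (R : comNzRingType) (I : ideal R).
Local Open Scope ideal_scope.

Lemma ideal_exp_mul i j x y :
  (I ^+ i) x -> (I ^+ j) y -> (I ^+ (i + j)%N) (x * y)%R.
Proof.
elim: i x y => [|i IHi] x y; first by move=> _ Ijy; exact: idealM.
rewrite addSn => Ix Ijy.
suff: \colon(I ^+ (i + j).+1, I ^+ j) x by apply.
apply: (ideal_mul_sub _ Ix) => a b Ia Ib z Ijz; rewrite -mulrA.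
by apply: ideal_mulP => //; exact: IHi.
Qed.

(** The Rees algebra, i.e. the direct sum of the [I ^+ i * 'X^i] *)
Definition rees_mem : {poly R} -> bool :=
  fun p => `[< forall i, (I ^+ i) p`_i >].

Fact rees_mem_subring_closed : subring_closed rees_mem.
Proof.
split=> [|p q /asboolP Ip /asboolP Iq|p q /asboolP Ip /asboolP Iq]; apply/asboolP => i.
- by rewrite coef1; case: i => [|i]; [exact: Logic.I | exact: ideal0].
- by rewrite coefB; apply: idealD => //; exact: idealN.
- rewrite coefM; elim/big_ind: _ => [|x y|k _]; [exact: ideal0|exact: idealD|].
  by rewrite -{1}(subnKC (ltnSE (ltn_ord k))); exact: ideal_exp_mul.
Qed.

HB.instance Definition _ :=
  GRing.isSubringClosed.Build {poly R} rees_mem rees_mem_subring_closed.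

Record rees := Rees { rees_val : {poly R}; rees_valP : rees_val \in rees_mem }.

HB.instance Definition _ := [isSub for rees_val].
HB.instance Definition _ := [Choice of rees by <:].
HB.instance Definition _ := [SubChoice_isSubComNzRing of rees by <:].

Fact rees_const_subproof (x : R) : x%:P \in rees_mem.
Proof.
apply/asboolP=> i; rewrite coefC.
by case: i => [|i]; [exact: Logic.I | exact: (ideal0 (I ^+ i.+1))].
Qed.

Definition rees_const (x : R) : rees := Rees (rees_const_subproof x).

Fact rees_const_zmod_morphism : zmod_morphism rees_const.
Proof. by move=> x y; apply: val_inj; rewrite /= polyCB. Qed.

Fact rees_const_monoid_morphism : monoid_morphism rees_const.
Proof. by split=> [|x y]; apply: val_inj; rewrite /= ?polyCM. Qed.

HB.instance Definition _ :=
  GRing.isZmodMorphism.Build R rees rees_const rees_const_zmod_morphism.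
HB.instance Definition _ :=
  GRing.isMonoidMorphism.Build R rees rees_const rees_const_monoid_morphism.

Definition rees_shift_set : set rees :=
  [set p | forall i, (I ^+ i.+1) (rees_val p)`_i].

Fact rees_shift0 : rees_shift_set 0.
Proof. by move=> i; rewrite coef0; exact: ideal0. Qed.

Fact rees_shiftD p q :
  rees_shift_set p -> rees_shift_set q -> rees_shift_set (p + q)%R.
Proof. by move=> Ip Iq i; rewrite coefD; exact: idealD. Qed.

Fact rees_shiftM a p : rees_shift_set p -> rees_shift_set (a * p)%R.
Proof.
move=> Ip i; rewrite coefM.
elim/big_ind: _ => [|x y|k _]; [exact: ideal0|exact: idealD|].
rewrite -{1}(subnKC (ltnSE (ltn_ord k))) -addnS; apply: ideal_exp_mul => //.
exact: (asboolP _ (rees_valP a)).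
Qed.

Definition rees_shift : ideal rees :=
  Ideal rees_shift0 rees_shiftD rees_shiftM.

(** The direct sum of the [I^i / I^(i+1)] *)
Definition assoc_graded : Type := quotient rees_shift.
HB.instance Definition _ := GRing.ComPzRing.on assoc_graded.

Definition assoc_graded_const : {rmorphism R -> assoc_graded} :=
  quotient_pi rees_shift \o rees_const.

Definition analytic_spread_is (m : max_ideal R) : nat -> Prop :=
  krull_dim_is (base_change assoc_graded_const m).

End AssociatedGraded.

Section Reductions.
Variable R : comPzRingType.
Implicit Types I J K : ideal R.
Local Open Scope ideal_scope.

Definition reduction J I : Prop :=
  J `<=` I /\ exists n, I ^+ n.+1 = J * I ^+ n.

Definition minimal_reduction J I : Prop :=
  reduction J I /\ forall K, reduction K I -> K `<=` J -> K = J.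

Definition reduction_number_wrt J I : nat :=
  nat_min [set n | I ^+ n.+1 = J * I ^+ n].

Definition reduction_number I : nat :=
  nat_min [set reduction_number_wrt J I | J in [set J | minimal_reduction J I]].

Definition core I : ideal R :=
  ideal_bigcap [set J | reduction J I] id.

End Reductions.

(* Main.v *)
Require Import Defs.
From HB Require Import structures.
From mathcomp Require Import all_boot all_order all_algebra.
From mathcomp Require Import boolp classical_sets functions cardinality.

Set Implicit Arguments.
Unset Strict Implicit.
Unset Printing Implicit Defensive.

Import GRing.Theory.
Local Open Scope classical_set_scope.
Local Open Scope ring_scope.

(** By unmixedness every element generating a reduction of [I] is regular, and since
    the residue field is infinite every reduction contains a principal one; write
    [J = (a)]. For regular [y] generating a reduction of [K], whether
    [K ^+ n.+1 = y * K ^+ n] holds depends only on [n], by cancellation. Taking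
    [K = (a, y i)], an element [c] with [c * K ^+ n] inside [(a ^+ n.+1)] has
    [c * a ^+ n.+1] in [y i * c * K ^+ n], hence is a multiple of [y i]; so the colon
    ideals lie in the core. Conversely, for [z] in [I] a generic [w = a + l * z]
    generates a reduction of [I], so [core I] lies in many ideals [(w)]; Lagrange
    interpolation for the products of these [w] turns this into
    [core I * (a, z) ^+ n] inside [(a ^+ n.+1)] for every [n]. Part (b) follows because
    the powers [z ^+ r] generate [I ^+ r] when [r`!] is invertible. *)

(** * Arithmetic of ideals *)

Section IdealArithmetic.
Variable R : comNzRingType.
Implicit Types (I J K L M N : ideal R) (a b c x z : R).

Lemma gen_sub (S : set R) K : S `<=` K -> ideal_gen S `<=` K.
Proof. by move=> SK x; apply. Qed.

Lemma sub_gen (S : set R) : S `<=` ideal_gen S.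
Proof. by move=> x Sx K; apply. Qed.

Lemma idealMl K a x : K x -> K (x * a).
Proof. by rewrite mulrC; exact: idealM. Qed.

Lemma idealB K x z : K x -> K z -> K (x - z).
Proof. by move=> Kx Kz; apply: idealD => //; exact: idealN. Qed.

Lemma ideal_sum K (T : Type) (s : seq T) (F : T -> R) :
  (forall i, K (F i)) -> K (\sum_(i <- s) F i).
Proof. by move=> KF; elim/big_ind: _ => //; [exact: ideal0 | exact: idealD]. Qed.

Lemma ideal_subP I K : I `<=` K -> K `<=` I -> I = K.
Proof. by move=> IK KI; apply: ideal_eqP; apply/seteqP. Qed.

Lemma principalP a x : ideal_principal a x <-> exists b, x = b * a.
Proof.
split=> [|[b ->]]; last by apply: idealM; exact: sub_gen.
pose S := [set x | exists b, x = b * a].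
have S0 : S 0 by exists 0; rewrite mul0r.
have SD x1 x2 : S x1 -> S x2 -> S (x1 + x2).
  by move=> [b ->] [c ->]; exists (b + c); rewrite mulrDl.
have SM c x1 : S x1 -> S (c * x1) by move=> [b ->]; exists (c * b); rewrite mulrA.
by apply: (gen_sub (K := Ideal S0 SD SM)) => _ ->; exists 1; rewrite mul1r.
Qed.

Lemma principal_id a : ideal_principal a a.
Proof. exact: sub_gen. Qed.

Lemma principal_sub a K : K a -> ideal_principal a `<=` K.
Proof. by move=> Ka; apply: gen_sub => _ ->. Qed.

Lemma ideal_addP I K x : (I + K)%ID x <-> exists u v, [/\ I u, K v & x = (u + v)].
Proof.
split=> [|[u [v [Iu Kv ->]]]]; last first.
  by apply: idealD; apply: sub_gen; [left | right].
pose S := [set x | exists u v, [/\ I u, K v & x = (u + v)]].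
have S0 : S 0 by exists 0, 0; rewrite addr0; split=> //; exact: ideal0.
have SD x1 x2 : S x1 -> S x2 -> S (x1 + x2).
  move=> [u [v [Iu Kv ->]]] [u' [v' [Iu' Kv' ->]]].
  by exists (u + u'), (v + v'); rewrite addrACA; split=> //; exact: idealD.
have SM b x1 : S x1 -> S (b * x1).
  move=> [u [v [Iu Kv ->]]].
  by exists (b * u), (b * v); rewrite mulrDr; split=> //; exact: idealM.
apply: (gen_sub (K := Ideal S0 SD SM)) => z [Iz|Kz].
  by exists z, 0; rewrite addr0; split=> //; exact: ideal0.
by exists 0, z; rewrite add0r; split=> //; exact: ideal0.
Qed.

Lemma ideal_addl I K : I `<=` (I + K)%ID.
Proof. by move=> x Ix; apply: sub_gen; left. Qed.

Lemma ideal_addr I K : K `<=` (I + K)%ID.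
Proof. by move=> x Kx; apply: sub_gen; right. Qed.

Lemma ideal_add_sub I K L : I `<=` L -> K `<=` L -> (I + K)%ID `<=` L.
Proof. by move=> IL KL; apply: gen_sub; rewrite subUset. Qed.

Lemma ideal_mulS I I' K K' : I `<=` I' -> K `<=` K' -> (I * K)%ID `<=` (I' * K')%ID.
Proof.
by move=> II' KK'; apply: ideal_mul_sub => a b /II' ? /KK' ?; exact: ideal_mulP.
Qed.

Lemma ideal_mul_subr I K : (I * K)%ID `<=` K.
Proof. by apply: ideal_mul_sub => a b _; exact: idealM. Qed.

Lemma ideal_mulDr I K L : (I * (K + L))%ID `<=` (I * K + I * L)%ID.
Proof.
apply: ideal_mul_sub => a _ Ia /ideal_addP [u [v [Ku Lv ->]]].
rewrite mulrDr; apply: idealD.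
  by apply: ideal_addl; exact: ideal_mulP.
by apply: ideal_addr; exact: ideal_mulP.
Qed.

Lemma principal_mulP a K x :
  (ideal_principal a * K)%ID x <-> exists2 v, K v & x = (a * v).
Proof.
split=> [|[v Kv ->]]; last by apply: ideal_mulP Kv; exact: principal_id.
pose S := [set x | exists2 v, K v & x = (a * v)].
have S0 : S 0 by exists 0; [exact: ideal0 | rewrite mulr0].
have SD x1 x2 : S x1 -> S x2 -> S (x1 + x2).
  by move=> [u Ku ->] [v Kv ->]; exists (u + v); [exact: idealD | rewrite mulrDr].
have SM b x1 : S x1 -> S (b * x1).
  by move=> [u Ku ->]; exists (b * u); [exact: idealM | rewrite mulrCA].
apply: (ideal_mul_sub (K := Ideal S0 SD SM)) => _ v /principalP [b ->] Kv.
by exists (b * v); [exact: idealM | rewrite mulrAC mulrC].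
Qed.

Lemma ideal_mulC I K : (I * K)%ID = (K * I)%ID.
Proof.
by apply: ideal_subP; apply: ideal_mul_sub => a b Ia Kb;
  rewrite mulrC; exact: ideal_mulP.
Qed.

Lemma colon_principalP K a x : (\colon(K, ideal_principal a))%ID x <-> K (x * a).
Proof.
split=> [|Kxa _ /principalP [b ->]]; first by apply; exact: principal_id.
by rewrite mulrCA; exact: idealM.
Qed.

Lemma gen_consE x (s : seq R) :
  ideal_gen [set` x :: s] = (ideal_principal x + ideal_gen [set` s])%ID.
Proof.
apply: ideal_subP.
  apply: gen_sub => z /predU1P [->|sz].
    by apply: ideal_addl; exact: principal_id.
  by apply: ideal_addr; exact: sub_gen.
apply: ideal_add_sub.
  by apply: principal_sub; apply: sub_gen; exact: mem_head.
by apply: gen_sub => z sz; apply: sub_gen; apply/predU1P; right.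
Qed.

Lemma gen_rconsE x (s : seq R) :
  ideal_gen [set` rcons s x] = (ideal_principal x + ideal_gen [set` s])%ID.
Proof.
rewrite -gen_consE; congr ideal_gen; apply/seteqP.
by split=> z /=; rewrite mem_rcons.
Qed.

Lemma gen_seqP (s : seq R) x :
  ideal_gen [set` s] x <-> exists c : 'I_(size s) -> R, x = \sum_i c i * s`_i.
Proof.
elim: s x => [|z s IHs] x.
  split=> [|[c ->]]; last by rewrite big_ord0; exact: ideal0.
  move/(gen_sub (K := ideal_principal 0)) => /(_ (fun z zP => False_ind _ (notF zP))).
  move=> /principalP [b ->]; rewrite mulr0.
  by exists (fun=> 0); rewrite big_ord0.
rewrite gen_consE; split=> [/ideal_addP [_ [v [/principalP [b ->] /IHs [c ->] ->]]]|[c ->]].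
  exists (fun i => if unlift ord0 i is Some j then c j else b).
  rewrite big_ord_recl unlift_none; congr (_ + _).
  by apply: eq_bigr => i _; rewrite liftK.
rewrite big_ord_recl; apply: idealD.
  by apply: ideal_addl; apply: idealM; exact: principal_id.
by apply: ideal_addr; apply/IHs; exists (fun i => c (lift ord0 i)).
Qed.

Lemma ideal_expS I K n : I `<=` K -> (I ^+ n)%ID `<=` (K ^+ n)%ID.
Proof. by move=> IK; elim: n => // n IHn; exact: ideal_mulS. Qed.

Lemma ideal_exp_elt I a n : I a -> (I ^+ n)%ID (a ^+ n).
Proof. by move=> Ia; elim: n => // n IHn; rewrite exprS; exact: ideal_mulP. Qed.

Lemma principal_expP a n x :
  (ideal_principal a ^+ n)%ID x <-> exists b, x = (b * a ^+ n).
Proof.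
split=> [|[b ->]]; last by apply: idealM; apply: ideal_exp_elt; exact: principal_id.
elim: n x => [|n IHn] x; first by exists x; rewrite mulr1.
move=> /principal_mulP [v /IHn [b ->] ->].
by exists b; rewrite exprS mulrCA.
Qed.

Lemma colon_bigsumP K (T : Type) (D : set T) (F : T -> ideal R) c :
  (\colon(K, ideal_bigsum D F))%ID c <-> forall i u, D i -> F i u -> K (c * u).
Proof.
split=> [Kc i u Di Fu|Kc u]; first by apply: Kc; apply: sub_gen; exists i.
move=> Fu; rewrite mulrC; apply/colon_principalP.
apply: gen_sub Fu => v [i Di Fv]; apply/colon_principalP.
by rewrite mulrC; exact: Kc Di Fv.
Qed.

End IdealArithmetic.

(** * Noetherian rings: ascending chains, associated primes, Nakayama's lemma *)

Section NoetherianLocal.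
Variable R : comNzRingType.
Hypothesis Rnoeth : noetherian R.
Implicit Types (H I J K L M N P : ideal R) (a b c x z : R).

(** The union of the chain is an ideal whose finitely many generators already lie in one term. *)
Lemma noetherian_acc (U : nat -> ideal R) : (forall n, U n `<=` U n.+1) ->
  exists n, U n.+1 `<=` U n.
Proof.
move=> Uinc.
have Ule i j : (i <= j)%N -> U i `<=` U j.
  move=> /subnK <-; elim: (j - i)%N => [//|k IHk x /IHk]; exact: Uinc.
pose V := \bigcup_(n in [set: nat]) U n.
have V0 : V 0 by exists 0%N => //; exact: ideal0.
have VD x z : V x -> V z -> V (x + z).
  move=> [i _ Ux] [j _ Uz]; exists (maxn i j) => //.
  by apply: idealD; [exact: Ule (leq_maxl i j) _ Ux | exact: Ule (leq_maxr i j) _ Uz].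
have VM a x : V x -> V (a * x) by move=> [i _ Ux]; exists i => //; exact: idealM.
have [s Vs] := Rnoeth (Ideal V0 VD VM).
have [n sn] : exists n, [set` s] `<=` U n.
  have : [set` s] `<=` V.
    by move=> x sx; change (Ideal V0 VD VM x); rewrite Vs; exact: sub_gen.
  elim: s {Vs} => [_|x s IHs xsV]; first by exists 0%N.
  have [|n sn] := IHs; first by move=> z sz; apply: xsV; apply/predU1P; right.
  have [|i _ Ux] := xsV x; first exact: mem_head.
  exists (maxn n i) => z /predU1P [->|/sn Uz]; first exact: Ule (leq_maxr n i) _ Ux.
  exact: Ule (leq_maxl n i) _ Uz.
exists n => x Ux; apply: (gen_sub sn); rewrite -Vs.
by exists n.+1.
Qed.

Lemma noetherian_max (S : set (ideal R)) I : S I ->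
  exists M, [/\ S M, I `<=` M & forall K, S K -> M `<=` K -> K = M].
Proof.
move=> SI; apply: contrapT => nomax.
have step M : exists K, S M -> I `<=` M -> [/\ S K, M `<=` K & ~ K `<=` M].
  have [SM|] := pselect (S M); last by exists M.
  have [IM|] := pselect (I `<=` M); last by exists M.
  apply: contrapT => noK; apply: nomax; exists M; split=> // K SK MK.
  apply: ideal_subP => //; apply: contrapT => KM.
  by apply: noK; exists K.
have [f fP] := choice step.
pose U n := iter n f I.
have UP n : S (U n) /\ I `<=` U n.
  elim: n => [|n [SU IU]]; first by split.
  have [SfU UfU _] := fP _ SU IU.
  by split=> //; exact: subset_trans UfU.
have [n] := @noetherian_acc U (fun n => let: And3 _ h _ := fP _ (UP n).1 (UP n).2 in h).
by have [_ _] := fP _ (UP n).1 (UP n).2.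
Qed.

(** A maximal colon [(H : d)] with [d] outside [H] is prime: if [a * b * d] is in [H] and [b * d] is
    not, then [(H : b * d)] equals [(H : d)] by maximality, and it contains [a]. *)
Lemma exists_assoc_prime H c : ~ H c ->
  exists d, [/\ prime_ideal (\colon(H, ideal_principal d))%ID, ~ H d &
    (\colon(H, ideal_principal c))%ID `<=` (\colon(H, ideal_principal d))%ID].
Proof.
move=> Hc.
pose S := [set (\colon(H, ideal_principal d))%ID | d in [set d | ~ H d]].
have [|_ [[d Hd <-] cd dmax]] := @noetherian_max S (\colon(H, ideal_principal c))%ID.
  by exists c.
exists d; split=> //; split=> [/colon_principalP|a b /colon_principalP abd].
  by rewrite mul1r.
have [bd|bd] := pselect (H (b * d)); first by right; apply/colon_principalP.
left; rewrite -(dmax (\colon(H, ideal_principal (b * d)))%ID).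
- by apply/colon_principalP; rewrite mulrA.
- by exists (b * d).
- by move=> x /colon_principalP xd; apply/colon_principalP; rewrite mulrCA; exact: idealM.
Qed.

Variable m : max_ideal R.
Hypothesis Rlocal : forall n : ideal R, maximal_ideal n -> n = m.

Lemma max_ideal1 : ~ m 1.
Proof. by case: (max_idealP m). Qed.

Lemma local_unit x : ~ m x -> exists x', x' * x = 1.
Proof.
move=> mx; apply: contrapT => xinv.
have [|M [M1 xM Mmax]] :=
    @noetherian_max [set K : ideal R | ~ K 1] (ideal_principal x).
  by move=> /principalP [b bx]; apply: xinv; exists b.
have Mm : M = m by apply: Rlocal; split=> // K MK K1; exact: Mmax.
by apply: mx; rewrite -Mm; apply: xM; exact: principal_id.
Qed.

Lemma local_cancel K u x : ~ m u -> K (u * x) -> K x.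
Proof.
move=> /local_unit [u' u'u] Kux.
by rewrite -[x]mul1r -u'u -mulrA; exact: idealM.
Qed.

(** Induction on the generators of [N]: the first one satisfies [x = p * x + w] with [p] in [m], and
    [1 - p] is a unit, so [x] can be expressed through the others. *)
Lemma nakayama M N : N `<=` (M + m * N)%ID -> N `<=` M.
Proof.
have [s ->] := Rnoeth N; elim: s => [|x s IHs] NM.
  by apply: gen_sub => z.
set G := ideal_gen [set` s].
have MGx z : (ideal_principal x + G)%ID z ->
    exists p w, [/\ m p, (M + m * G)%ID w & z = p * x + w].
  move=> Gz; have : (M + m * ideal_gen [set` x :: s])%ID z.
    by apply: NM; rewrite gen_consE.
  move=> /ideal_addP [u [v [Mu]]]; rewrite gen_consE => /ideal_mulDr.
  move=> /ideal_addP [v1 [v2 [mv1 mv2 ->]]] ->.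
  move: mv1; rewrite [(m * ideal_principal x)%ID]ideal_mulC => /principal_mulP [p mp ->].
  exists p, (u + v2); split=> //; last by rewrite addrCA mulrC.
  by apply: idealD; [exact: ideal_addl | exact: ideal_addr].
have MmG : (M + m * (ideal_principal x + G))%ID `<=` (M + m * G)%ID.
  have MGx' : (M + m * G)%ID x.
    have [|p [w [mp MGw xE]]] := MGx x.
      by apply: ideal_addl; exact: principal_id.
    apply: (@local_cancel _ (1 - p)); last by rewrite mulrBl mul1r {1}xE addrAC subrr add0r.
    by move=> m1p; apply: max_ideal1; rewrite -(subrK p 1); exact: idealD.
  apply: ideal_add_sub; first exact: ideal_addl.
  apply: subset_trans (@ideal_mulDr _ _ _ _) _.
  apply: ideal_add_sub; last exact: ideal_addr.
  by apply: subset_trans (@ideal_mul_subr _ _ _) _; exact: principal_sub.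
have NMG : (ideal_principal x + G)%ID `<=` (M + m * G)%ID.
  by rewrite -gen_consE; apply: subset_trans NM _; rewrite gen_consE.
have GM : G `<=` M by apply: IHs => z Gz; apply: NMG; exact: ideal_addr.
rewrite gen_consE; apply: subset_trans NMG _; apply: ideal_add_sub => // z mGz.
by apply: GM; exact: ideal_mul_subr mGz.
Qed.

End NoetherianLocal.

(** * Cohen-Macaulay rings: zero divisors and primes of height zero *)

Section CohenMacaulay.
Variables (R : comNzRingType) (m : max_ideal R).
Hypothesis Rlocal : local_ring m.
Implicit Types (H K P Q : ideal R) (a c d x y : R).

Lemma prime_chain_cons k P (Q : nat -> ideal R) : prime_ideal P -> P `<` Q 0%N ->
  prime_chain k Q -> prime_chain k.+1 (fun n => if n is n'.+1 then Q n' else P).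
Proof.
move=> Pprime PQ [Qprime Qlt]; split=> [[|i]|[|i]] //; rewrite ltnS.
- exact: Qprime.
- exact: Qlt.
Qed.

(** With [N = (H : P)], Nakayama gives an element of [N] outside [(x) + H]; an
    associated prime containing its annihilator modulo [(x) + H] contains [P] and [x]. *)
Lemma assoc_prime_step H x d : m x -> (forall a, H (a * x) -> H a) -> ~ H d ->
  prime_ideal (\colon(H, ideal_principal d))%ID ->
  exists d', [/\ ~ (ideal_principal x + H)%ID d',
    prime_ideal (\colon(ideal_principal x + H, ideal_principal d'))%ID &
    (\colon(H, ideal_principal d))%ID `<`
      (\colon(ideal_principal x + H, ideal_principal d'))%ID].
Proof.
move=> mx xreg Hd; set P := (\colon(H, ideal_principal d))%ID => Pprime.
pose N := (\colon(H, P))%ID.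
have [c Nc Hxc] : exists2 c, N c & ~ (ideal_principal x + H)%ID c.
  apply: contrapT => noc; apply: Hd.
  (* Since [d] is in [N], this is absurd. If [N] is inside [(x) + H], write [c = b * x + h];
     regularity of [x] modulo [H] puts [b] in [N], so [N] is inside [H + m * N]. *)
  suff NH : N `<=` H.
    by apply: NH => p /colon_principalP; rewrite mulrC.
  apply: (nakayama Rlocal.1 Rlocal.2) => c Nc.
  have : (ideal_principal x + H)%ID c by apply: contrapT => Hxc; apply: noc; exists c.
  move=> /ideal_addP [_ [h [/principalP [b ->] Hh cE]]].
  rewrite cE addrC; apply: idealD; first exact: ideal_addl.
  apply: ideal_addr; rewrite mulrC; apply: ideal_mulP => // p Pp.
  apply: xreg; rewrite mulrAC -[b * x](addrK h) -cE mulrBl.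
  by apply: idealB; [exact: Nc | exact: idealMl].
have [d' [Qprime Hxd' cd']] := exists_assoc_prime Rlocal.1 Hxc.
exists d'; split=> //; split=> [p Pp|QP].
  apply: cd'; apply/colon_principalP; apply: ideal_addr.
  by rewrite mulrC; exact: Nc.
have /colon_principalP : P x.
  apply: QP; apply/colon_principalP; apply: ideal_addl.
  by apply: idealMl; exact: principal_id.
by rewrite mulrC => /xreg.
Qed.

(** Each remaining term of the regular sequence contributes one strict inclusion of associated
    primes. *)
Lemma assoc_prime_chain (s : seq R) k i d : regular_sequence s -> [set` s] `<=` m ->
  (i + k)%N = size s -> ~ ideal_gen [set` take i s] d ->
  prime_ideal (\colon(ideal_gen [set` take i s], ideal_principal d))%ID ->
  exists2 Q, prime_chain k Q &
    Q 0%N = (\colon(ideal_gen [set` take i s], ideal_principal d))%ID.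
Proof.
move=> sreg sm; elim: k i d => [|k IHk] i d iks sd Pprime.
  by exists (fun=> (\colon(ideal_gen [set` take i s], ideal_principal d))%ID).
have si : (i < size s)%N by rewrite -iks -addSnnS leq_addr.
have [|d' []] := assoc_prime_step (x := s`_i) _ (sreg.2 i si) sd Pprime.
  by apply: sm; exact: mem_nth.
rewrite -gen_rconsE -take_nth // => sd' Qprime PQ.
have [|Q Qchain Q0] := IHk i.+1 d' _ sd' Qprime; first by rewrite addSnnS.
by eexists; first by apply: prime_chain_cons Pprime _ Qchain; rewrite Q0.
Qed.

Hypothesis RCM : cohen_macaulay m.

(** A zero divisor lies in an associated prime of zero. Such a prime starts a chain as long as the
    dimension, built from a regular sequence of that length, so no prime lies strictly below it. *)
Lemma cohen_macaulay_lreg y :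
  (forall P, prime_height_is P 0%N -> ~ P y) -> GRing.lreg y.
Proof.
move=> yP; apply: contrapT => yzd.
have [c yc c0] : exists2 c, y * c = 0 & c <> 0.
  apply: contrapT => noc; apply: yzd => c c' ycc'; apply/eqP; rewrite -subr_eq0.
  apply/eqP; apply: contrapT => cc'0; apply: noc; exists (c - c') => //.
  by rewrite mulrBr ycc' subrr.
(* The zero ideal, in the form it has as the start [take 0 s] of a regular sequence. *)
pose Z := ideal_gen [set` (@nil R)].
have Z0 x : Z x -> x = 0.
  move=> Zx; have /principalP [b ->] : ideal_principal 0 x; last exact: mulr0.
  by apply: gen_sub Zx => z.
have [|d [Pprime Zd cP]] := @exists_assoc_prime R Rlocal.1 Z c; first by move=> /Z0.
have Py : (\colon(Z, ideal_principal d))%ID y.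
  by apply: cP; apply/colon_principalP; rewrite yc; exact: ideal0.
apply: yP Py; split.
  by exists (fun=> (\colon(Z, ideal_principal d))%ID).
move=> [//|k] [P' P'chain P'k].
have [n [[_ nmax] [[s [sreg sm sn]] _]]] := RCM.
have [|||Q Qchain Q0] := @assoc_prime_chain s n 0 d sreg sm; rewrite ?take0 //.
suff /nmax : [set k | exists W : nat -> ideal R, prime_chain k W] n.+1 by rewrite ltnn.
eexists; apply: (prime_chain_cons (P := P' k)) Qchain; first exact: P'chain.1.
by rewrite Q0 take0 -/Z -P'k; exact: P'chain.2.
Qed.

End CohenMacaulay.

(** * The residue field: linear dependence and distinct residues *)

Section ResidueField.
Variables (R : comNzRingType) (m : max_ideal R).

Definition residue_inv (x : residue_field m) : residue_field m :=
  if x == 0 then 0 else xget 0 [set x' | x' * x = 1].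

Fact residue_mulVf x : x != 0 -> residue_inv x * x = 1.
Proof.
move=> x0; rewrite /residue_inv (negbTE x0).
case: xgetP => [//|noinv]; case/eqP: x0; rewrite -[x]quotient_reprK.
set z := repr x; have [m1 mmax] := max_idealP m.
rewrite -(rmorph0 (quotient_pi m)); apply/quotient_piP; rewrite subr0.
apply: contrapT => mz.
have /ideal_addP [_ [u [/principalP [b ->] mu E]]] : (ideal_principal z + m)%ID 1.
  apply: contrapT => zm1; apply: mz; rewrite -(mmax _ (@ideal_addr _ _ _) zm1).
  by apply: ideal_addl; exact: principal_id.
case: (noinv (quotient_pi m b)); rewrite -[x]quotient_reprK -/z /=.
rewrite -[LHS](quotient_piM m); apply/quotient_piP.
by rewrite E opprD addrA subrr sub0r; exact: idealN.
Qed.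

Fact residue_inv0 : residue_inv 0 = 0.
Proof. by rewrite /residue_inv eqxx. Qed.

HB.instance Definition _ :=
  GRing.ComNzRing_isField.Build (residue_field m) residue_mulVf residue_inv0.

Definition residue_pi : {rmorphism R -> residue_field m} := quotient_pi m.

Lemma residue_pi_eq0 x : residue_pi x = 0 <-> m x.
Proof.
rewrite -(rmorph0 residue_pi); split=> [/quotient_piP|mx]; first by rewrite subr0.
by apply/quotient_piP; rewrite subr0.
Qed.

(** With more rows than columns, the matrix has a nonzero left kernel vector over the residue field;
    representatives of its entries give [c]. *)
Lemma residue_dependency q (A : 'M[R]_(q.+1, q)) :
  exists2 c : 'I_q.+1 -> R, exists i, ~ m (c i) &
    forall j, m (\sum_i c i * A i j).
Proof.
pose B := map_mx residue_pi A.
have /rowV0Pn [v /sub_kermxP vB v0] : kermx B != 0.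
  by rewrite -mxrank_eq0 mxrank_ker -lt0n subn_gt0 ltnS rank_leq_col.
exists (fun i => repr (v 0 i)).
  apply: contrapT => cm; case/eqP: v0; apply/rowP => i; rewrite mxE.
  rewrite -[LHS]quotient_reprK; apply/(residue_pi_eq0 _).
  by apply: contrapT => ?; apply: cm; exists i.
move=> j; apply/residue_pi_eq0; rewrite rmorph_sum.
have := congr1 (fun w : 'rV__ => w 0 j) vB; rewrite !mxE; apply: etrans.
apply: eq_bigr => i _; rewrite rmorphM mxE; congr (_ * _).
exact: quotient_reprK.
Qed.

Lemma infinite_residue_field_seq : infinite_set [set: residue_field m] ->
  exists l : nat -> R, forall i j, m (l i - l j) -> i = j.
Proof.
move=> /infiniteP /card_leP [f].
exists (fun i => repr (val (f (to_setT i)))) => i j /quotient_piP.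
rewrite !quotient_reprK => /val_inj fij.
have /(congr1 val) // : to_setT i = to_setT j.
by apply: (@inj _ _ _ f) fij; rewrite inE.
Qed.

End ResidueField.

(** * Principal reductions and cancellation *)

Section PrincipalReductions.
Variable R : comNzRingType.
Implicit Types (C I J K L M S : ideal R) (a b c u v w x y z : R) (n : nat).

(** Elementwise form of [I ^+ n.+1 = a * I ^+ n]: the ideal [(a)] is a reduction of [I] with
    reduction number at most [n]. *)
Definition stable_at a I n : Prop :=
  I a /\ forall u, (I ^+ n.+1)%ID u -> exists2 v, (I ^+ n)%ID v & u = a * v.

Lemma stable_atP a I n : I a ->
  (I ^+ n.+1)%ID = (ideal_principal a * I ^+ n)%ID <-> stable_at a I n.
Proof.
move=> Ia; split=> [IE|[_ aI]].
  by split=> // u; rewrite IE => /principal_mulP.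
apply: ideal_subP => [u /aI ?|]; first exact/principal_mulP.
by apply: ideal_mulS => //; exact: principal_sub.
Qed.

Lemma reduction_stableP a I :
  reduction (ideal_principal a) I <-> exists n, stable_at a I n.
Proof.
split=> [[aI [n IE]]|[n aIn]].
  by exists n; apply/stable_atP => //; apply: aI; exact: principal_id.
have Ia := aIn.1; split; first exact: principal_sub.
by exists n; apply/stable_atP.
Qed.

Lemma stable_at_le a I n n' : (n <= n')%N -> stable_at a I n -> stable_at a I n'.
Proof.
move=> /subnK <-; elim: (n' - n)%N => [//|k IHk /IHk [Ia aI]].
split=> // u Iu; apply/principal_mulP; apply: ideal_mul_sub Iu => b _ Ib /aI [v Iv ->].
by rewrite mulrCA; apply: ideal_mulP; [exact: principal_id | exact: ideal_mulP].
Qed.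

Lemma stable_at_exp a I n k u : stable_at a I n -> (I ^+ (k + n))%ID u ->
  exists2 v, (I ^+ n)%ID v & u = a ^+ k * v.
Proof.
move=> aIn; elim: k u => [|k IHk] u Iu; first by exists u; rewrite ?mul1r.
have [_ aI] := stable_at_le (leq_addl k n) aIn.
have [_ /IHk [v Iv ->] ->] := aI _ Iu.
by exists v; rewrite // exprS mulrA.
Qed.

Lemma lreg_dvd a b : GRing.lreg (a * b) -> GRing.lreg a.
Proof.
move=> ab x x' axx'; apply: ab; rewrite -!mulrA [b * x]mulrC [b * x']mulrC.
by rewrite !mulrA axx'.
Qed.

Lemma stable_at_lreg a b I n : GRing.lreg b -> I b -> stable_at a I n -> GRing.lreg a.
Proof.
move=> breg Ib [_ aI]; have [v _ bE] := aI _ (ideal_exp_elt n.+1 Ib).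
by apply: (@lreg_dvd a v); rewrite -bE; exact: lregX.
Qed.

(** The reduction number does not depend on the regular principal reduction:
    [I ^+ N = z ^+ (N - n) * I ^+ n], and [z] may be cancelled. *)
Lemma stable_at_indep a z I n N : GRing.lreg z -> stable_at z I n ->
  stable_at a I N -> stable_at a I n.
Proof.
move=> zreg zIn aIN; split=> [|u Iu]; first exact: aIN.1.
have [_ aI] := stable_at_le (leq_addr n N) aIN.
have [|v Iv zuE] := aI (z ^+ N * u).
  by rewrite -addnS; apply: ideal_exp_mul Iu; apply: ideal_exp_elt; exact: zIn.1.
have [v' Iv' vE] := stable_at_exp zIn Iv.
by exists v' => //; apply: (lregX (n := N) zreg); rewrite zuE vE mulrCA.
Qed.

(** [U j] is the part of the fractional ideal [a ^+ n * (K / a) ^+ j] lying in [R]. The chain pauses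
    at some [N]. For [v] in [K ^+ N.+1], stability in [I] gives [a ^+ n * v = a ^+ N.+1 * u] with
    [u] in [U N.+1], hence in [U N]; cancelling [a ^+ n] puts [v] in [a * K ^+ N]. *)
Lemma stable_at_sub a I K n : noetherian R -> GRing.lreg a -> stable_at a I n ->
  K a -> K `<=` I -> exists N, stable_at a K N.
Proof.
move=> Rnoeth areg aIn Ka KI.
pose U j := (\colon(ideal_principal (a ^+ n) * K ^+ j, ideal_principal (a ^+ j)))%ID.
have [|N UN] := @noetherian_acc R Rnoeth U.
  move=> j u /colon_principalP /principal_mulP [v Kv uE].
  apply/colon_principalP/principal_mulP; exists (a * v); first exact: ideal_mulP.
  by rewrite exprS mulrCA uE mulrCA.
exists N; split=> // v Kv.
have [|u _ avE] := @stable_at_exp a I n N.+1 (a ^+ n * v) aIn.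
  rewrite addnC; apply: ideal_exp_mul; last exact: ideal_expS Kv.
  by apply: ideal_exp_elt; exact: aIn.1.
have /UN /colon_principalP /principal_mulP [v' Kv' uE] : U N.+1 u.
  by apply/colon_principalP/principal_mulP; exists v => //; rewrite mulrC.
exists v' => //; apply: (lregX (n := n) areg).
by rewrite avE exprS -mulrA [a ^+ N * u]mulrC uE mulrCA.
Qed.

(** [c * K ^+ n] lies in [(a ^+ n.+1)], and [a ^+ n.+1] is in [y * K ^+ n]. *)
Lemma colon_sub_principal a y K n c : GRing.lreg a -> K a -> stable_at y K n ->
  (forall u, (K ^+ n)%ID u -> (ideal_principal a ^+ n.+1)%ID (c * u)) ->
  ideal_principal y c.
Proof.
move=> areg Ka [_ yK] cK.
have [u /cK /principal_expP [b cuE] aE] := yK _ (ideal_exp_elt n.+1 Ka).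
apply/principalP; exists b; apply: (lregX (n := n.+1) areg).
by rewrite mulrC {1}aE mulrCA cuE mulrCA [in RHS]mulrC mulrA mulrC mulrA.
Qed.

(** Elements of [C] have the form [b * a], and cancelling [a] turns a condition modulo [a ^+ n.+1]
    on [b * a] into one modulo [a ^+ n] on [b]. *)
Lemma core_eq_mul a C S n : GRing.lreg a -> C `<=` ideal_principal a ->
  C = (\colon(ideal_principal a ^+ n.+1, S))%ID ->
  C = (ideal_principal a * \colon(ideal_principal a ^+ n, S))%ID.
Proof.
move=> areg Ca CE; apply: ideal_subP => [c Cc|c /principal_mulP [b bS ->]].
  have /principalP [b cE] := Ca _ Cc.
  apply/principal_mulP; exists b; last by rewrite mulrC.
  move=> u Su; apply/principal_expP; move: Cc; rewrite CE => /(_ _ Su).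
  move=> /principal_expP [d cuE]; exists d; apply: areg.
  by rewrite mulrCA mulrA -cE cuE exprS mulrCA.
rewrite CE => u /bS /principal_expP [d buE]; apply/principal_expP; exists d.
by rewrite -mulrA buE mulrCA exprS.
Qed.

End PrincipalReductions.

(** * Generic elements of reductions *)

Section GenericCombination.
Variables (R : comNzRingType) (m : max_ideal R).
Hypothesis Rlocal : local_ring m.
Implicit Types (I K L M : ideal R) (a b u v y z : R).

(** The Chinese remainder theorem in the ring generated by the fractions [w i / y]:
    more than [size g] pairwise comaximal proper submodules [N i] of [M] would give
    too many elements independent modulo [m * M]. *)
Lemma comaximal_not_all_proper (g : seq R) y (w : 'I_(size g).+1 -> R)
    (N : 'I_(size g).+1 -> ideal R) (M := ideal_gen [set` g]) :
  GRing.lreg y -> (forall i, N i `<=` M) -> (forall i, (m * M)%ID `<=` N i) ->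
  (forall i j u, N i u -> exists2 v, N i v & w j * u = y * v) ->
  (forall i u, M u -> exists2 v, N i v & w i * u = y * v) ->
  (forall i j u, i != j -> M u -> exists v x, [/\ M v, N i x & y * u = w j * v + y * x]) ->
  exists i, M `<=` N i.
Proof.
move=> yreg NM mMN wN wM sep.
(* Products of the fractions [w j / y] preserve every submodule that each of them preserves. *)
have prodK K s v : (forall j u, K u -> exists2 v, K v & w j * u = y * v) -> K v ->
    exists2 v', K v' & (\prod_(j <- s) w j) * v = y ^+ size s * v'.
  move=> wK Kv; elim: s => [|j s [v' Kv' E]]; first by exists v; rewrite ?big_nil.
  have [v'' Kv'' E'] := wK j v' Kv'; exists v'' => //.
  by rewrite big_cons -mulrA E mulrCA E' mulrA exprSr.
have wMM j u : M u -> exists2 v, M v & w j * u = y * v.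
  by move=> /(wM j) [v /NM]; exists v.
(* The factor [w j / y] sends [M] into [N j], and the other factors keep it there. *)
have prodN s j v : j \in s -> M v ->
    exists2 v', N j v' & (\prod_(k <- s) w k) * v = y ^+ size s * v'.
  move=> + Mv; elim: s => [//|k s IHs] /predU1P [<-|/IHs [v' Nv' E]].
    have [v' /(wM j) [x Nx E'] E] := prodK M s v wMM Mv; exists x => //.
    by rewrite big_cons -mulrA E mulrCA E' mulrA exprSr.
  have [x Nx E'] := wN j k v' Nv'; exists x => //.
  by rewrite big_cons -mulrA E mulrCA E' mulrA exprSr.
apply: contrapT => noi.
have indep i : exists f, [/\ M f, ~ N i f & forall j, j != i -> N j f].
  have [u Mu Nu] : exists2 u, M u & ~ N i u.
    apply: contrapT => nou; apply: noi; exists i => u Mu.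
    by apply: contrapT => Nu; apply: nou; exists u.
  pose s := [seq j <- enum 'I_(size g).+1 | j != i].
  (* Comaximality, used once per index in [s]: modulo [N i], the product of all fractions with index
     other than [i] is still onto. *)
  have [v [x [Mv Nx uE]]] : exists v x, [/\ M v, N i x &
      y ^+ size s * u = (\prod_(j <- s) w j) * v + y ^+ size s * x].
    have : all (fun j => i != j) s.
      by apply/allP => j; rewrite mem_filter eq_sym => /andP [].
    elim: s => [_|j s IHs /andP [ij /IHs [v [x [Mv Nx E]]]]].
      exists u, 0; split=> //; first exact: ideal0.
      by rewrite big_nil mulr0 addr0.
    have [v' [x' [Mv' Nx' E']]] := sep i j v ij Mv.
    have [x'' Nx'' E''] := prodK (N i) s x' (wN i) Nx'.
    exists v', (x'' + x); split=> //; first exact: idealD.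
    rewrite exprS -[LHS]mulrA E mulrDr [y * (_ * v)]mulrCA E' mulrDr.
    rewrite [_ * (y * x')]mulrCA E'' big_cons mulrDr !mulrA addrA.
    by congr (_ * _ + _ + _); rewrite mulrC.
  have [f Mf fE] := prodK M s v wMM Mv.
  have yX : GRing.lreg (y ^+ size s) by exact: lregX.
  exists f; split=> // [Nf|j ji].
    apply: Nu; suff -> : u = f + x by apply: idealD.
    by apply: yX; rewrite uE fE mulrDr.
  have [|f' Nf' f'E] := prodN s j v _ Mv; first by rewrite mem_filter ji mem_enum.
  by rewrite (_ : f = f') //; apply: yX; rewrite -fE f'E.
have [f fP] := choice indep.
have /choice [A AE] : forall i, exists c : 'I_(size g) -> R, f i = \sum_k c k * g`_k.
  by move=> i; apply/gen_seqP; have [] := fP i.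
(* The [f i] outnumber the generators, so a combination of them with a unit coefficient [c i] lies
   in [m * M], hence in [N i]. All terms but the [i]-th are in [N i] too, which forces [f i] into
   [N i]. *)
have [c [i mci] cA] := residue_dependency m (\matrix_(i, k) A i k).
have [_ Nfi _] := fP i; apply: Nfi.
apply: (local_cancel Rlocal.1 Rlocal.2 mci).
have -> : c i * f i = \sum_j c j * f j - \sum_(j | j != i) c j * f j.
  by rewrite (bigD1 i) //= addrK.
apply: idealB.
  have -> : \sum_j c j * f j = \sum_k (\sum_j c j * A j k) * g`_k.
    under eq_bigr do rewrite AE mulr_sumr.
    rewrite exchange_big; apply: eq_bigr => k _.
    by rewrite mulr_suml; apply: eq_bigr => j _; rewrite mulrA.
  apply: (mMN i); apply: ideal_sum => k.
  apply: ideal_mulP; last by apply: sub_gen; exact: mem_nth.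
  by have := cA k; under eq_bigr do rewrite mxE.
elim/big_ind: _ => [|x x'|j ji]; [exact: ideal0 | exact: idealD |].
by apply: idealM; have [_ _] := fP j; apply; rewrite eq_sym.
Qed.

(** Trades the two generators [a], [b] of [K] for one combination. For distinct [i], [j] the unit
    [l j - l i] shows that [W i] and [w j] generate [K], so the submodules [N i], with
    [y * N i = Q i], are comaximal. Hence some [N i] is [M], and Nakayama removes the term with
    [m]. *)
Lemma generic_combination (g : seq R) y L a b (l : 'I_(size g).+1 -> R)
    (M := ideal_gen [set` g]) (K := (L + ideal_principal a + ideal_principal b)%ID) :
  GRing.lreg y -> (K * M)%ID `<=` (ideal_principal y * M)%ID ->
  (ideal_principal y * M)%ID `<=` (K * M)%ID -> (forall i j, m (l i - l j) -> i = j) ->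
  exists i, (ideal_principal y * M)%ID `<=` ((L + ideal_principal (a + l i * b)) * M)%ID.
Proof.
move=> yreg KMy yKM linj.
pose w i := a + l i * b.
pose W i := (L + ideal_principal (w i))%ID.
have Kw i : K (w i).
  apply: idealD; first by apply/ideal_addl/ideal_addr; exact: principal_id.
  by apply/ideal_addr/principalP; exists (l i).
have WK i : W i `<=` K.
  apply: ideal_add_sub; last exact: principal_sub.
  by move=> x Lx; apply/ideal_addl/ideal_addl.
pose Q i := (W i * M + m * (ideal_principal y * M))%ID.
pose N i := (\colon(Q i, ideal_principal y))%ID.
have QyM i : Q i `<=` (ideal_principal y * M)%ID.
  apply: ideal_add_sub; last exact: ideal_mul_subr.
  by apply: subset_trans KMy; exact: ideal_mulS.
have NM i : N i `<=` M.
  move=> u /colon_principalP /QyM /principal_mulP [v Mv uE].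
  by rewrite (_ : u = v) //; apply: yreg; rewrite mulrC.
have wM j u : M u -> exists2 v, M v & w j * u = y * v.
  by move=> Mu; apply/principal_mulP/KMy; exact: ideal_mulP.
have wQ i j : Q i `<=` (\colon(ideal_principal y * Q i, ideal_principal (w j)))%ID.
  apply: ideal_add_sub; apply: ideal_mul_sub => e u We.
    move=> /(wM j) [v Mv E]; apply/colon_principalP/principal_mulP.
    exists (e * v); last by rewrite -mulrA [u * _]mulrC E mulrCA.
    by apply: ideal_addl; exact: ideal_mulP.
  move=> /principal_mulP [u' /(wM j) [v Mv E] ->].
  apply/colon_principalP/principal_mulP; exists (e * (y * v)).
    by apply: ideal_addr; apply: ideal_mulP => //; apply/principal_mulP; exists v.
  by rewrite -!mulrA [u' * _]mulrC E mulrCA.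
have [|||i j u ij|i MNi] := @comaximal_not_all_proper g y w N yreg NM.
- move=> i; apply: ideal_mul_sub => p u mp Mu; apply/colon_principalP/ideal_addr.
  rewrite -mulrA; apply: ideal_mulP => //; apply/principal_mulP.
  by exists u; rewrite // mulrC.
- move=> i j u Nu; have [v Mv E] := wM j u (NM _ _ Nu); exists v => //.
  move: Nu => /colon_principalP /(wQ i j) /colon_principalP /principal_mulP [x Qx xE].
  apply/colon_principalP; rewrite mulrC -E (_ : w j * u = x) //; apply: yreg.
  by rewrite -xE mulrCA [RHS]mulrC [u * y]mulrC.
- move=> i u Mu; have [v Mv E] := wM i u Mu; exists v => //.
  apply/colon_principalP; rewrite mulrC -E; apply: ideal_addl.
  by apply: ideal_mulP => //; apply: ideal_addr; exact: principal_id.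
- move=> Mu.
  have KWw : K `<=` (ideal_principal (w j) + W i)%ID.
    have Wb : (ideal_principal (w j) + W i)%ID b.
      apply: (@local_cancel _ Rlocal.1 _ Rlocal.2 _ (l j - l i)).
        by move=> /linj ji; rewrite ji eqxx in ij.
      have -> : (l j - l i) * b = w j - w i by rewrite mulrBl opprD addrACA subrr add0r.
      apply: idealB; first by apply: ideal_addl; exact: principal_id.
      by apply/ideal_addr/ideal_addr; exact: principal_id.
    apply: ideal_add_sub; last exact: principal_sub.
    apply: ideal_add_sub; first by move=> x Lx; apply/ideal_addr/ideal_addl.
    apply: principal_sub; rewrite -(addrK (l i * b) a).
    apply: idealB; last exact: idealM.
    by apply/ideal_addr/ideal_addr; exact: principal_id.
  have : (M * (ideal_principal (w j) + W i))%ID (y * u).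
    rewrite ideal_mulC; apply: (ideal_mulS KWw (@subset_refl _ _)); apply: yKM.
    by apply: ideal_mulP => //; exact: principal_id.
  move=> /ideal_mulDr; rewrite [(M * ideal_principal _)%ID]ideal_mulC [(M * W i)%ID]ideal_mulC.
  move=> /ideal_addP [_ [e [/principal_mulP [v Mv ->] WMe ->]]].
  have Qe : Q i e by exact: ideal_addl.
  have /QyM /principal_mulP [x Mx eE] := Qe.
  by exists v, x; split=> //; [apply/colon_principalP; rewrite mulrC -eE | rewrite eE].
exists i; apply: (nakayama Rlocal.1 Rlocal.2) => _ /principal_mulP [v /MNi + ->].
by move=> /colon_principalP; rewrite mulrC.
Qed.

Lemma reduction_exp_le K I n n' : (n <= n')%N -> (I ^+ n.+1)%ID `<=` (K * I ^+ n)%ID ->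
  (I ^+ n'.+1)%ID `<=` (K * I ^+ n')%ID.
Proof.
move=> /subnK <-; elim: (n' - n)%N => [//|k IHk /IHk IK].
apply: ideal_mul_sub => x u Ix /IK; move: u.
suff : (K * I ^+ (k + n))%ID `<=`
    (\colon(K * I ^+ (k + n).+1, ideal_principal x))%ID.
  by move=> KI u /KI /colon_principalP; rewrite mulrC.
apply: ideal_mul_sub => c u Kc Iu; apply/colon_principalP; rewrite -mulrA.
by apply: ideal_mulP => //; rewrite mulrC; exact: ideal_mulP.
Qed.

Hypothesis kinf : infinite_set [set: residue_field m].

(** The generators of [K] are absorbed one at a time into a single element [z] by generic
    combinations, acting on the module [M = I ^+ n]; so [z] inherits the same [n] as [y]. *)
Lemma reduction_sub_principal I K y n : GRing.lreg y -> stable_at y I n ->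
  reduction K I -> exists2 z, K z & stable_at z I n.
Proof.
move=> yreg yIn [KI [N IKN]].
have [g gE] := Rlocal.1 (I ^+ n)%ID; set M := ideal_gen [set` g] in gE.
have IMy : (I * M)%ID `<=` (ideal_principal y * M)%ID.
  by move=> x; rewrite -gE => /(yIn.2 _); rewrite -principal_mulP.
(* In degree [N + n] the reduction [K] gives [I ^+ (N + n).+1] inside [K * y ^+ N * I ^+ n]; then
   [y ^+ N] cancels. *)
have yKM : (ideal_principal y * M)%ID `<=` (K * M)%ID.
  rewrite -gE => _ /principal_mulP [u Iu ->].
  have : (K * I ^+ (N + n))%ID (y ^+ N * (y * u)).
    apply: (reduction_exp_le (leq_addr n N)); first by rewrite IKN.
    rewrite -addnS; apply: ideal_exp_mul; first by apply: ideal_exp_elt; exact: yIn.1.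
    by apply: ideal_mulP => //; exact: yIn.1.
  have KIy : (K * I ^+ (N + n))%ID `<=` (ideal_principal (y ^+ N) * (K * I ^+ n))%ID.
    apply: ideal_mul_sub => c _ Kc /(stable_at_exp yIn) [v Iv ->].
    by rewrite mulrCA; apply: ideal_mulP; [exact: principal_id | exact: ideal_mulP].
  by move=> /KIy /principal_mulP [v KIv /(lregX yreg) ->].
have [l linj] := infinite_residue_field_seq kinf.
suff [z Kz yz] : exists2 z, K z &
    (ideal_principal y * M)%ID `<=` (ideal_principal z * M)%ID.
  exists z => //; split=> [|u Iu]; first exact: KI.
  by rewrite gE; apply/principal_mulP/yz/IMy; rewrite -gE.
have [s sE] := Rlocal.1 K.
have : exists2 z, K z &
    (ideal_principal y * M)%ID `<=` ((ideal_gen [set` s] + ideal_principal z) * M)%ID.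
  exists 0; first exact: ideal0.
  apply: subset_trans yKM _; apply: ideal_mulS => //; rewrite sE; exact: ideal_addl.
have : [set` s] `<=` K by rewrite sE; exact: sub_gen.
elim: s {sE} => [_ [z Kz yz]|b s IHs sK [z Kz yz]].
  exists z => //; apply: subset_trans yz _; apply: ideal_mulS => //.
  by apply: ideal_add_sub => //; apply: gen_sub.
have sK' : [set` s] `<=` K by move=> x sx; apply: sK; apply/predU1P; right.
have Kb : K b by apply: sK; exact: mem_head.
apply: IHs => //.
have [||i j|i yi] := @generic_combination g y (ideal_gen [set` s]) z b
  (fun i => l i) yreg.
- apply: subset_trans IMy; apply: ideal_mulS => //.
  apply: ideal_add_sub; last by apply: principal_sub; exact: KI.
  apply: ideal_add_sub; last by apply: principal_sub; exact: KI.
  by apply: gen_sub => x /sK' /KI.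
- apply: subset_trans yz _; apply: ideal_mulS => //; rewrite gen_consE.
  apply: ideal_add_sub; last by move=> x zx; apply/ideal_addl/ideal_addr.
  apply: ideal_add_sub => [|x sx]; first exact: ideal_addr.
  by apply/ideal_addl/ideal_addl.
- by move=> /linj /val_inj.
exists (z + l i * b) => //; apply: idealD => //; exact: idealM.
Qed.

(** Among any [(size g).+1] distinct residues one is good, so every tail of [l] contains a good one
    and a subsequence consists of good ones. *)
Lemma generic_stable_at I a z n : GRing.lreg a -> stable_at a I n -> I z ->
  exists l : nat -> R, (forall i j, m (l i - l j) -> i = j) /\
    forall i, stable_at (a + l i * z) I n.
Proof.
move=> areg aIn Iz; have [l linj] := infinite_residue_field_seq kinf.
have [g gE] := Rlocal.1 (I ^+ n)%ID; set M := ideal_gen [set` g] in gE.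
have IMa : (I * M)%ID `<=` (ideal_principal a * M)%ID.
  by move=> x; rewrite -gE => /(aIn.2 _); rewrite -principal_mulP.
have Ia := aIn.1.
have unbounded N : exists i, (N <= i)%N /\ stable_at (a + l i * z) I n.
  have [||i j|i ai] := @generic_combination g a (ideal_principal 0) a z
    (fun i => l (N + i)%N) areg.
  - apply: subset_trans IMa; apply: ideal_mulS => //.
    apply: ideal_add_sub; last exact: principal_sub.
    by apply: ideal_add_sub; apply: principal_sub => //; exact: ideal0.
  - apply: ideal_mulS => //; apply: principal_sub.
    by apply/ideal_addl/ideal_addr; exact: principal_id.
  - by move=> /linj /addnI /val_inj.
  exists (N + i)%N; split; first exact: leq_addr.
  have wI : I (a + l (N + i)%N * z) by apply: idealD => //; exact: idealM.
  split=> // u Iu; rewrite gE; apply/principal_mulP.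
  suff : ((ideal_principal 0 + ideal_principal (a + l (N + i)%N * z)) * M)%ID u.
    apply: ideal_mulS => //; apply: ideal_add_sub => //.
    by apply: principal_sub; exact: ideal0.
  by apply/ai/IMa; rewrite -gE.
have [f fP] := choice unbounded.
(* [f N] is a good index at least [N], so [k] lists good indices in increasing order. *)
pose k := fix k i := if i is i'.+1 then f (k i').+1 else f 0%N.
have kinc i j : (i < j)%N -> (k i < k j)%N.
  elim: j => [//|j IHj]; rewrite ltnS leq_eqVlt => /predU1P [->|/IHj kij].
    exact: (fP (k j).+1).1.
  exact: leq_trans kij (ltnW (fP (k j).+1).1).
exists (fun i => l (k i)); split=> [i j /linj kij|[|i]]; last 2 first.
- exact: (fP 0%N).2.
- exact: (fP (k i).+1).2.
by have [/kinc||//] := ltngtP i j; [rewrite kij ltnn | move=> /kinc; rewrite kij ltnn].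
Qed.

End GenericCombination.

Lemma nat_minP (S : set nat) : S !=set0 -> S (nat_min S).
Proof.
move=> [n0 Sn0]; rewrite /nat_min; case: xgetP => [_ _ [] //|nomin].
have exS : exists n, `[< S n >] by exists n0; apply/asboolP.
case: (ex_minnP exS) => k /asboolP Sk kmin; case: (nomin k); split=> // j Sj.
by apply: kmin; apply/asboolP.
Qed.

(** * Reduction numbers, interpolation, and multiplication by the core *)

Section ReductionsAndCore.
Variables (R : comNzRingType) (m : max_ideal R).
Hypothesis Rlocal : local_ring m.
Hypothesis kinf : infinite_set [set: residue_field m].
Implicit Types (H I K L : ideal R) (a c u v x y z : R).

(** A smaller reduction contains a principal one [(z)] with [z = c * a]. If [c] is in [m],
    cancelling [a] in [a * I ^+ n] inside [z * I ^+ n] gives [I ^+ n] inside [m * I ^+ n], so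
    [I ^+ n] vanishes although it contains the regular element [a ^+ n]. *)
Lemma stable_at_minimal I a n : GRing.lreg a -> stable_at a I n ->
  minimal_reduction (ideal_principal a) I.
Proof.
move=> areg aIn; split=> [|K Kred Ka]; first by apply/reduction_stableP; exists n.
have [z Kz zIn] := reduction_sub_principal Rlocal kinf areg aIn Kred.
have /principalP [c zE] := Ka _ Kz.
apply: ideal_subP => //; apply: principal_sub.
have [mc|mc] := pselect (m c); last first.
  by apply: (local_cancel Rlocal.1 Rlocal.2 mc); rewrite -zE.
have I0 : (I ^+ n)%ID `<=` ideal_principal 0.
  apply: (nakayama Rlocal.1 Rlocal.2) => u Iu; apply: ideal_addr.
  have [|v Iv auE] := zIn.2 (a * u); first by apply: ideal_mulP => //; exact: aIn.1.
  rewrite (_ : u = c * v); first exact: ideal_mulP.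
  by apply: areg; rewrite auE zE -mulrA mulrCA.
have /principalP [b an0] := I0 _ (ideal_exp_elt n aIn.1).
have /eqP : (1 : R) = 0.
  by apply: (lregX (n := n) areg); rewrite an0 mulr0 !mul0r.
by rewrite oner_eq0.
Qed.

(** The minimum is attained at a minimal reduction [L], which is principal because it contains a
    principal reduction; the index then passes from its generator to [y]. *)
Lemma reduction_number_stable_at I y n : GRing.lreg y -> stable_at y I n ->
  stable_at y I (reduction_number I).
Proof.
move=> yreg yIn.
have [|L Lmin] := @nat_minP [set reduction_number_wrt L I | L in
    [set L | minimal_reduction L I]].
  exists (reduction_number_wrt (ideal_principal y) I), (ideal_principal y) => //.
  exact: stable_at_minimal yIn.
rewrite -/(reduction_number I) => <-.
have [[LI Ln] Lmin'] := Lmin.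
have [z Lz zIn] := reduction_sub_principal Rlocal kinf yreg yIn Lmin.1.
have zL : ideal_principal z = L.
  by apply: Lmin'; [apply/reduction_stableP; exists n | exact: principal_sub].
have zIr : stable_at z I (reduction_number_wrt L I).
  by apply/stable_atP; [exact: zIn.1 | rewrite zL; exact: (nat_minP Ln)].
exact: stable_at_indep (stable_at_lreg yreg yIn.1 zIn) zIr yIn.
Qed.

Section ProductsOfLines.
Variable l : nat -> R.
Hypothesis linj : forall i j, m (l i - l j) -> i = j.

(** The products omitting one factor span all forms of their degree, as in
    Lagrange interpolation. *)
Lemma exp_sub_prod_rem a z i s H : uniq (i :: s) ->
  (forall j, j \in i :: s -> H (\prod_(k <- rem j (i :: s)) (a + l k * z))) ->
  ((ideal_principal a + ideal_principal z) ^+ size s)%ID `<=` H.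
Proof.
elim: s i H => [|i' s IHs] i H.
  move=> _ /(_ i (mem_head _ _)); rewrite /= eqxx big_nil => H1 x _.
  by rewrite -(mulr1 x); exact: idealM.
move=> /andP [i_notin us] HW.
have ne j : j \in i' :: s -> (i == j) = false.
  by move=> js; apply: contraNF i_notin => /eqP ->.
have Hw j : j \in i' :: s ->
    H ((a + l i * z) * \prod_(k <- rem j (i' :: s)) (a + l k * z)).
  move=> js; have := HW j; rewrite in_cons js orbT => /(_ isT).
  by rewrite [rem _ _]/= ne // big_cons.
(* The hypothesis for [i] gives the product over all of [i' :: s], the one for [j] trades the factor
   of [j] for that of [i]; their difference is [l j - l i] times the element sought. *)
have Hz j : j \in i' :: s -> H (z * \prod_(k <- rem j (i' :: s)) (a + l k * z)).
  move=> js; apply: (@local_cancel _ Rlocal.1 _ Rlocal.2 _ (l j - l i)).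
    by move=> /linj ji; have := ne j js; rewrite ji eqxx.
  have -> : forall p, (l j - l i) * (z * p) = (a + l j * z) * p - (a + l i * z) * p.
    by move=> p; rewrite -mulrBl opprD addrACA subrr add0r -mulrBl mulrA.
  apply: idealB; last exact: Hw.
  have := HW i (mem_head _ _); rewrite [rem _ _]/= eqxx.
  by rewrite (big_rem j).
(* The induction hypothesis for the ideal [(H : x)], used with [x = z] and [x = a + l i * z], which
   together generate [(a, z)]. *)
have sub x : (forall j, j \in i' :: s ->
      H (x * \prod_(k <- rem j (i' :: s)) (a + l k * z))) ->
    ((ideal_principal a + ideal_principal z) ^+ size s)%ID `<=`
      (\colon(H, ideal_principal x))%ID.
  move=> Hx; apply: (IHs i') => // j js; apply/colon_principalP.
  by rewrite mulrC; exact: Hx.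
apply: ideal_mul_sub => x u Kx Ku; move: x Kx.
suff KH : (ideal_principal a + ideal_principal z)%ID `<=`
    (\colon(H, ideal_principal u))%ID.
  by move=> x /KH /colon_principalP.
have /colon_principalP zu := sub z Hz u Ku.
apply: ideal_add_sub; apply: principal_sub; apply/colon_principalP; rewrite mulrC //.
have /colon_principalP wu := sub _ Hw u Ku.
rewrite -(addrK (l i * z) a) mulrBr; apply: idealB => //.
by rewrite mulrCA; exact: idealM.
Qed.

(** Divide [p - p.[x]] by ['X - x] for the first point [x]. Values of the quotient at later points,
    times a unit difference of points, are differences of values of [p]; induct on the size with the
    shifted sequence. *)
Lemma poly_coef_ideal H (p : {poly R}) k : (forall i, H p.[l i]) -> H p`_k.
Proof.
move: (leqnn (size p)); move: {2}(size p) => n.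
elim: n p k l linj => [|n IHn] p k l' linj'.
  by rewrite leqn0 size_poly_eq0 => /eqP -> _; rewrite coef0; exact: ideal0.
move=> sp Hp; pose x := l' 0%N.
have /factor_theorem [q pE] : root (p - p.[x]%:P) x.
  by rewrite rootE !hornerE subrr.
have Hq j : H q`_j.
  apply: (IHn q j (fun i => l' i.+1)) => [i i' /linj' [] //||i].
    have [->|q0] := eqVneq q 0; first by rewrite size_poly0.
    have : (size (q * ('X - x%:P))%R <= n.+1)%N.
      rewrite -pE; apply: leq_trans (size_polyD _ _) _; rewrite geq_max sp size_polyN.
      exact: leq_trans (size_polyC_leq1 _) _.
    by rewrite size_Mmonic ?monicXsubC // size_XsubC addn2.
  apply: (@local_cancel _ Rlocal.1 _ Rlocal.2 _ (l' i.+1 - x)); first by move=> /linj'.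
  have := congr1 (fun q' => q'.[l' i.+1]) pE; rewrite !hornerE => qE.
  by rewrite mulrC -qE; apply: idealB; exact: Hp.
rewrite -(subrK p.[x]%:P p) pE coefD mulrBr coefB coefMX coefMC coefC.
apply: idealD; first apply: idealB.
- by case: eqP => _ //; exact: ideal0.
- by rewrite mulrC; exact: idealM.
- by case: eqP => _; [exact: Hp | exact: ideal0].
Qed.

End ProductsOfLines.

(** Polarization: [j.+1 * x ^+ j * z] is a coefficient of [(x + 'X * z) ^+ j.+1]. *)
Lemma exp_sub_powers I H k : (forall j, (0 < j <= k)%N -> ~ m j%:R) ->
  (forall z, I z -> H (z ^+ k)) -> (I ^+ k)%ID `<=` H.
Proof.
move=> mk Hk; have [l linj] := infinite_residue_field_seq kinf.
(* Here [j] factors are already equal to [x] and [e] are still arbitrary; the induction lowers [e]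
   to zero. *)
suff Hxu e j x u : (e + j)%N = k -> I x -> (I ^+ e)%ID u -> H (x ^+ j * u).
  by move=> u Iu; rewrite -[u]mul1r; apply: (Hxu k 0%N 0); rewrite ?addn0 //; exact: ideal0.
elim: e j x u => [|e IHe] j x u ejk Ix.
  by move=> _; rewrite mulrC; apply: idealM; rewrite -[j]add0n ejk; exact: Hk.
move: u; suff : (I ^+ e.+1)%ID `<=` (\colon(H, ideal_principal (x ^+ j)))%ID.
  by move=> IH u /IH /colon_principalP; rewrite mulrC.
apply: ideal_mul_sub => z v Iz Iv; apply/colon_principalP.
pose p : {poly R} := (x%:P + z *: 'X) ^+ j.+1 * v%:P.
have p1 : p`_1 = j.+1%:R * (z * v * x ^+ j).
  have := coef_deriv p 0; rewrite mulr1n => <-; rewrite -horner_coef0.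
  rewrite derivM derivC mulr0 addr0 deriv_exp derivD derivC add0r derivZ derivX.
  by rewrite !(hornerE, hornerMn) /= mulr_natl -!mulrnAl mulrAC.
apply: (@local_cancel _ Rlocal.1 _ Rlocal.2 _ j.+1%:R); last rewrite -p1.
  by apply: mk; rewrite ltn0Sn /= -ejk addSnnS leq_addl.
(* The value of [p] at [l i] is [(x + l i * z) ^+ j.+1 * v], which has one arbitrary factor
   fewer. *)
apply: (poly_coef_ideal linj) => i; rewrite !hornerE.
apply: IHe => //; first by rewrite -addSnnS.
by apply: idealD => //; rewrite mulrC; exact: idealM.
Qed.

Lemma natr_max_ideal r : [pchar (residue_field m)] =i pred0 \/
    (exists2 p, p \in [pchar (residue_field m)] & (r < p)%N) ->
  forall j, (0 < j <= r)%N -> ~ m j%:R.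
Proof.
move=> charm j /andP [j0 jr] /residue_pi_eq0 /eqP; rewrite rmorph_nat => mj.
case: charm => [char0|[p pchar rp]].
  by have [p] := natf0_pchar j0 mj; rewrite char0.
move: mj; rewrite -(dvdn_pcharf pchar) => /(dvdn_leq j0) pj.
by have := leq_trans rp (leq_trans pj jr); rewrite ltnn.
Qed.

(** Each [w i] divides [c], so interpolation gives [c * K ^+ N] inside [(W)]. Stability of [a] in
    [K] gives [W * a ^+ (N - k) * u = a ^+ N.+1 * v] with [v] in [K ^+ N]. Multiplying by [c] and
    cancelling [W] and [a ^+ (N - k)] leaves [c * u] in [(a ^+ k.+1)]. *)
Lemma core_mul_exp I a n z c k u : GRing.lreg a -> stable_at a I n -> I z ->
  core I c -> ((ideal_principal a + ideal_principal z) ^+ k)%ID u ->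
  (ideal_principal a ^+ k.+1)%ID (c * u).
Proof.
move=> areg aIn Iz corec; set K := (ideal_principal a + ideal_principal z)%ID => Ku.
have Ka : K a by apply: ideal_addl; exact: principal_id.
have KI : K `<=` I by apply: ideal_add_sub; apply: principal_sub => //; exact: aIn.1.
have [N0 aKN0] := stable_at_sub Rlocal.1 areg aIn Ka KI.
(* Large enough for stability in [K], and for [u] to be raised to degree [N] by a power of [a]. *)
pose N := maxn N0 k; have aKN := stable_at_le (leq_maxl N0 k) aKN0.
have [l [linj wI]] := generic_stable_at Rlocal kinf areg aIn Iz.
pose w i := a + l i * z; pose W := \prod_(i <- iota 0 N.+1) w i.
have wreg i : GRing.lreg (w i) by exact: stable_at_lreg areg aIn.1 (wI i).
have Wreg : GRing.lreg W.
  by rewrite /W; elim/big_ind: _ => // [|x y]; [exact: lreg1 | exact: lregM].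
have Wc i : i \in iota 0 N.+1 ->
    (\colon(ideal_principal W, ideal_principal c))%ID (\prod_(j <- rem i (iota 0 N.+1)) w j).
  move=> iN; have /principalP [b ->] : ideal_principal (w i) c.
    by apply: (corec (ideal_principal (w i))); apply/reduction_stableP; exists n; exact: wI.
  apply/colon_principalP/principalP; exists b.
  by rewrite /W (big_rem i iN) /= mulrC -mulrA.
have KNW := exp_sub_prod_rem linj (iota_uniq 0 N.+1) Wc; rewrite size_iota in KNW.
have WK s v : (K ^+ N)%ID v ->
    exists2 v', (K ^+ N)%ID v' & (\prod_(i <- s) w i) * v = a ^+ size s * v'.
  move=> Kv; elim: s => [|i s [v' Kv' E]]; first by exists v; rewrite ?big_nil.
  have [|v'' Kv'' E'] := aKN.2 (w i * v').
    apply: ideal_mulP => //; apply: idealD => //; apply: idealM.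
    by apply: ideal_addr; exact: principal_id.
  by exists v'' => //; rewrite big_cons -mulrA E mulrCA E' mulrA exprSr.
have Kau : (K ^+ N)%ID (a ^+ (N - k) * u).
  rewrite -{1}(subnK (leq_maxr N0 k) : (N - k + k)%N = N).
  by apply: ideal_exp_mul => //; exact: ideal_exp_elt.
have [v Kv] := WK (iota 0 N.+1) _ Kau; rewrite size_iota -/W => WE.
have /KNW /colon_principalP /principalP [b vcE] := Kv.
apply/principal_expP; exists b; apply: (lregX (n := N - k) areg).
apply: Wreg; rewrite [a ^+ _ * (c * u)]mulrCA [LHS]mulrCA WE [LHS]mulrCA [c * v]mulrC vcE.
rewrite [a ^+ _ * (b * _)]mulrCA -exprD addnS subnK ?leq_maxr //.
by rewrite [RHS]mulrA [RHS]mulrC [W * b]mulrC.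
Qed.

End ReductionsAndCore.

(** If [y] were in a prime of height zero, then so would be [I ^+ n.+1], hence [I], against height
    one. *)
Lemma reduction_lreg (R : comNzRingType) (m : max_ideal R) (I : ideal R) (y : R) :
  local_ring m -> cohen_macaulay m -> height_is I 1 ->
  reduction (ideal_principal y) I -> GRing.lreg y.
Proof.
move=> Rlocal RCM [_ htI] /reduction_stableP [n [_ yI]].
apply: (cohen_macaulay_lreg Rlocal RCM) => P [[Q [Qprime _] QP] Pht] Py.
have Pprime : prime_ideal P by rewrite -QP; exact: Qprime.
suff /htI : [set h | exists P, [/\ prime_ideal P, I `<=` P & prime_height_is P h]] 0%N.
  by [].
exists P; split=> //; last by split=> //; exists Q.
move=> x Ix; have [v _ xE] := yI _ (ideal_exp_elt n.+1 Ix).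
have : P (x ^+ n.+1) by rewrite xE mulrC; exact: idealM.
elim: n.+1 => [/Pprime.1 //|k IHk]; rewrite exprS.
by move=> /(Pprime.2 _ _) [|/IHk].
Qed.

(** * Colon formulas for the core *)

Local Open Scope ideal_scope.

Theorem theorem3p4 (R : comNzRingType) (m : max_ideal R)
    (Rlocal : local_ring m) (RCM : cohen_macaulay m)
    (kinf : infinite_set [set: residue_field m])
    (I : ideal R) (ell_I : analytic_spread_is I m 1) (ht_I : height_is I 1)
    (J : ideal R) (J_min : minimal_reduction J I)
    (t : nat) (y : 'I_t -> R)
    (y_min : forall i, minimal_reduction (ideal_principal (y i)) I)
    (core_y : core I = ideal_bigcap [set: 'I_t] (fun i => ideal_principal (y i))) :
  let r := reduction_number I in
  let s := (\max_(i < t) reduction_number (J + ideal_principal (y i)))%N in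
  let Sall n := ideal_bigsum I (fun z : R => (J + ideal_principal z) ^+ n) in
  let Sfin n := ideal_bigsum [set: 'I_t]
                (fun i => (J + ideal_principal (y i)) ^+ n) in
  (forall n, (s <= n)%N ->
    [/\ core I = \colon(J ^+ n.+1, Sall n),
        core I = J * \colon(J ^+ n, Sall n),
        core I = \colon(J ^+ n.+1, Sfin n) &
        core I = J * \colon(J ^+ n, Sfin n)])
  /\
  ([pchar (residue_field m)] =i pred0 \/
     (exists2 p, p \in [pchar (residue_field m)] & (r < p)%N) ->
   forall n, (r <= n)%N ->
    core I = \colon(J ^+ n.+1, I ^+ n) /\
    core I = J * \colon(J ^+ n, I ^+ n)).
Proof.
move=> r s Sall Sfin.
have yreg i : GRing.lreg (y i) := reduction_lreg Rlocal RCM ht_I (y_min i).1.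
have coreJ : core I `<=` J by move=> c; apply; exact: J_min.1.
(* For [t = 0] the empty intersection would make the core the whole ring, yet it lies in a prime
   containing [I]. *)
have [i0] : exists i0 : 'I_t, True.
  apply: contrapT => no_i; have [[P [Pprime IP _]] _] := ht_I.
  case: Pprime.1; apply/IP/J_min.1.1/coreJ; rewrite core_y => i _.
  by case: no_i; exists i.
move=> _.
have ystable i : stable_at (y i) I r.
  have /reduction_stableP [n yIn] := (y_min i).1.
  exact: (reduction_number_stable_at Rlocal kinf (yreg i) yIn).
have [a Ja aIr] := reduction_sub_principal Rlocal kinf (yreg i0) (ystable i0) J_min.1.
have JE : J = ideal_principal a.
  symmetry; apply: J_min.2; last exact: principal_sub.
  by apply/reduction_stableP; exists r.
have areg := stable_at_lreg (yreg i0) (ystable i0).1 aIr.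
have core_sub n c : core I c -> \colon(J ^+ n.+1, Sall n) c.
  move=> corec; apply/colon_bigsumP => z u Iz; rewrite JE => Ku.
  exact: (core_mul_exp Rlocal kinf areg aIr Iz corec Ku).
have aK i : (J + ideal_principal (y i))%ID a by apply: ideal_addl.
have yK i : (J + ideal_principal (y i))%ID (y i).
  by apply: ideal_addr; exact: principal_id.
have KI i : (J + ideal_principal (y i))%ID `<=` I.
  by apply: ideal_add_sub; [exact: J_min.1.1 | exact: (y_min i).1.1].
(* [(y i)] is also a reduction of the smaller ideal [J + (y i)], whose reduction number is at most
   [s]. *)
have ystableK n i : (s <= n)%N -> stable_at (y i) (J + ideal_principal (y i)) n.
  move=> sn; have [N yKN] := stable_at_sub Rlocal.1 (yreg i) (ystable i) (yK i) (KI i).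
  apply: stable_at_le (reduction_number_stable_at Rlocal kinf (yreg i) yKN).
  apply: leq_trans sn.
  exact: (@leq_bigmax _ (fun i => reduction_number (J + ideal_principal (y i)))).
have Sfin_core n c : (s <= n)%N -> \colon(J ^+ n.+1, Sfin n) c -> core I c.
  move=> sn /colon_bigsumP cK; rewrite core_y => i _.
  apply: colon_sub_principal areg (aK i) (ystableK n i sn) _ => u Ku.
  by rewrite -JE; exact: cK Ku.
have Sfin_Sall n : Sfin n `<=` Sall n.
  apply: gen_sub => u [i _ Ku]; apply: sub_gen; exists (y i) => //.
  exact: (ystable i).1.
rewrite JE in coreJ.
split=> [n sn|charm n rn].
  (* The core is inside the colon by [Sall n], which is inside the colon by [Sfin n], which is
     inside the core. *)
  have coreSall : core I = \colon(J ^+ n.+1, Sall n).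
    apply: ideal_subP => [c /core_sub //|c cS]; apply: (Sfin_core n) => // u /Sfin_Sall.
    exact: cS.
  have coreSfin : core I = \colon(J ^+ n.+1, Sfin n).
    apply: ideal_subP => [c /core_sub cS u /Sfin_Sall|c]; [exact: cS | exact: Sfin_core].
  by split=> //; rewrite JE; apply: core_eq_mul => //; rewrite -JE.
have coreI : core I = \colon(J ^+ n.+1, I ^+ n).
  apply: ideal_subP => c cI.
    (* Polarization is needed only in degree [r], where the characteristic allows it; for larger [n]
       one has [I ^+ n = a ^+ (n - r) * I ^+ r]. *)
    have cIr : I ^+ r `<=` \colon(J ^+ r.+1, ideal_principal c).
      apply: (exp_sub_powers Rlocal kinf (natr_max_ideal charm)) => z Iz.
      apply/colon_principalP; rewrite mulrC JE.
      apply: (core_mul_exp Rlocal kinf areg aIr Iz cI); apply: ideal_exp_elt.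
      by apply: ideal_addr; exact: principal_id.
    move=> u; rewrite -{1}(subnK rn) => /(stable_at_exp aIr) [v /cIr + ->].
    move=> /colon_principalP; rewrite JE => /principal_expP [b vcE].
    apply/principal_expP; exists b.
    by rewrite mulrCA [(c * v)%R]mulrC vcE mulrCA -exprD addnS subnK.
  rewrite core_y => i _.
  apply: (colon_sub_principal areg aIr.1 (stable_at_le rn (ystable i))) => u Iu.
  by rewrite -JE; exact: cI.
by split=> //; rewrite JE; apply: core_eq_mul => //; rewrite -JE.
Qed.
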